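(* For every $n\ge 1$, the SSSS-OOOO game on a $1\times n$ grid is a draw.
   Context: SSSS-OOOO game: on a $1\times n$ grid, initially empty, two players alternately write either an S or an O in an empty cell. The first player whose move produces four consecutive cells spelling SSSS or spelling OOOO wins (no matter who wrote the individual letters). If all cells are filled without producing either string, the play ends in a draw. Both players are assumed to play optimally: ''the game is a draw'' means that each player has a strategy guaranteeing that they do not lose. *)

(* Defs.v *)
From HB Require Import structures.
From mathcomp Require Import all_boot.

Set Implicit Arguments.
Unset Strict Implicit.
Unset Printing Implicit Defensive.

Variant letter := LetterS | LetterO.

Definition bool_of_letter (l : letter) : bool :=
  if l is LetterS then true else false.
Definition letter_of_bool (b : bool) : letter :=
  if b then LetterS else LetterO.
Lemma bool_of_letterK : cancel bool_of_letter letter_of_bool.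
Proof. by case. Qed.
HB.instance Definition _ := Finite.copy letter (can_type bool_of_letterK).

Variant player := Player1 | Player2.

Definition opponent (p : player) : player :=
  if p is Player1 then Player2 else Player1.

Definition board (n : nat) := {ffun 'I_n -> option letter}.

Definition move (n : nat) := ('I_n * letter)%type.

Definition empty_board (n : nat) : board n := [ffun=> None].

Definition write (n : nat) (b : board n) (m : move n) : board n :=
  [ffun i => if i == m.1 then Some m.2 else b i].

Definition spells4 (n : nat) (b : board n) (l : letter) : bool :=
  [exists k : 'I_n, (k + 4 <= n) &&
    [forall i : 'I_n, (k <= i < k + 4) ==> (b i == Some l)]].

Definition completed (n : nat) (b : board n) : bool :=
  spells4 b LetterS || spells4 b LetterO.

Definition full (n : nat) (b : board n) : bool :=
  [forall i : 'I_n, b i != None].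

(* Chronological: the last item is the most recent move. *)
Definition history (n : nat) := seq (move n).

Definition board_of (n : nat) (h : history n) : board n :=
  foldl (@write n) (empty_board n) h.

Definition to_move (n : nat) (h : history n) : player :=
  if odd (size h) then Player2 else Player1.

Definition finished (n : nat) (h : history n) : bool :=
  completed (board_of h) || full (board_of h).

Definition legal (n : nat) (h : history n) (m : move n) : bool :=
  ~~ finished h && (board_of h m.1 == None).

Inductive play (n : nat) : history n -> Prop :=
| play_start : play [::]
| play_move (h : history n) (m : move n) :
    play h -> legal h m -> play (rcons h m).

(* A play stops at the first completed string, so in a play the string on a
   completed board was produced by the last move. *)
Definition wins (n : nat) (p : player) (h : history n) : Prop :=
  play h /\ exists (h' : history n) (m : move n),
    [/\ h = rcons h' m, to_move h' = p & completed (board_of h)].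

Definition strategy (n : nat) := history n -> move n.

Definition follows (n : nat) (p : player) (s : strategy n) (h : history n) :
    Prop :=
  forall (h1 : history n) (m : move n) (h2 : history n),
    h = rcons h1 m ++ h2 -> to_move h1 = p -> m = s h1.

(* Strategies are arbitrary functions; legality is only required at the
   unfinished plays that are reached when p follows s.  Without it, a strategy
   could avoid losing by blocking the play with an illegal move. *)
Definition admissible (n : nat) (p : player) (s : strategy n) : Prop :=
  forall h : history n,
    play h -> follows p s h -> to_move h = p -> ~~ finished h -> legal h (s h).

Definition nonlosing (n : nat) (p : player) (s : strategy n) : Prop :=
  admissible p s /\
  forall h : history n, play h -> follows p s h -> ~ wins (opponent p) h.

Definition is_draw (n : nat) : Prop :=
  forall p : player, exists s : strategy n, nonlosing p s.

(* Main.v *)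
Require Import Defs.
From mathcomp Require Import all_boot.
From mathcomp Require Import zify.

Set Implicit Arguments.
Unset Strict Implicit.
Unset Printing Implicit Defensive.

(** A player never loses by keeping every filled cell that touches an empty
    cell _backed_: its neighbour on the far side, if there is one, carries the
    opposite letter.

    On a backed board without a finished string the adversary cannot complete
    one ([not_completed_write]): in a window with three equal letters and one
    empty cell, some neighbour of the empty cell has its far neighbour inside
    the window, with the same letter.  After a move of the adversary in cell
    [i], only [i] itself can fail to be backed ([backed_at_write]), since a
    further move removes empty cells and overwrites nothing.  If [i] still has
    an empty neighbour, the opposite letter written there makes the two cells
    back each other ([backed_write_adjacent]).  Otherwise the board is already
    backed, and the leftmost empty cell can be used: it lies at the edge of the
    grid or next to a filled cell, to which the same pairing applies
    ([backed_opening]).  Thus a backed board can be restored after every move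
    of the adversary ([backed_reply]), and also by the very first move, so both
    players can play this way whatever the parity of the grid is. *)

Definition other (l : letter) : letter :=
  if l is LetterS then LetterO else LetterS.

Lemma other_neq l : other l != l. Proof. by case: l. Qed.

Lemma otherK : involutive other. Proof. by case. Qed.

(** * Backed cells *)

Definition adjacent (n : nat) (i j : 'I_n) : bool :=
  (i.+1 == j :> nat) || (j.+1 == i :> nat).

(** [j + k = 2 i] says that [k] is the mirror image of [j] in [i]; when [i] is
    an end cell of the grid no such [k] exists and nothing is required. *)
Definition backed_at (n : nat) (b : board n) (i : 'I_n) : bool :=
  [forall j : 'I_n, forall k : 'I_n,
    [&& adjacent i j, j + k == i.*2 & b j == None] ==>
    ((b i == None) || (b k == omap other (b i)))].

Definition backed (n : nat) (b : board n) : bool :=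
  [forall i : 'I_n, backed_at b i].

Lemma backed_atP (n : nat) (b : board n) (i : 'I_n) :
  reflect (forall (j k : 'I_n) l, adjacent i j -> j + k = i.*2 ->
             b j = None -> b i = Some l -> b k = Some (other l))
          (backed_at b i).
Proof.
apply: (iffP forallP) => [bi j k l aij /eqP jk /eqP bj bil | bi j].
  by have /forallP /(_ k) := bi j; rewrite aij jk bj bil => /eqP.
apply/forallP => k; apply/implyP => /and3P[aij /eqP jk /eqP bj].
case bil: (b i) => [l|] //=; apply/eqP; exact: bi aij jk bj bil.
Qed.

Lemma write_same (n : nat) (b : board n) (i : 'I_n) l :
  write b (i, l) i = Some l.
Proof. by rewrite ffunE eqxx. Qed.

Lemma write_other (n : nat) (b : board n) (i j : 'I_n) l :
  j != i -> write b (i, l) j = b j.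
Proof. by rewrite ffunE => /negPf ->. Qed.

Lemma write_None (n : nat) (b : board n) (i j : 'I_n) l :
  write b (i, l) j = None -> j != i /\ b j = None.
Proof. by rewrite ffunE /=; case: eqP. Qed.

(** A move cannot spoil another cell: empty neighbours only become fewer, and
    a backing letter is never overwritten. *)
Lemma backed_at_write (n : nat) (b : board n) (i c : 'I_n) l :
  b i = None -> c != i -> backed_at b c -> backed_at (write b (i, l)) c.
Proof.
move=> bi ci /backed_atP bc; apply/backed_atP => j k x acj jk.
case/write_None=> _ bj; rewrite write_other // => bcx.
have bk := bc j k x acj jk bj bcx.
by rewrite write_other //; apply: contraTneq isT => ki; rewrite -ki bk in bi.
Qed.

(** The two cells back each other: the empty neighbour of either one, if any,
    lies on the side away from the other. *)
Lemma backed_write_adjacent (n : nat) (b : board n) (i j : 'I_n) l :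
  adjacent i j -> b i = Some l -> b j = None ->
  (forall c, c != i -> backed_at b c) -> backed (write b (j, other l)).
Proof.
move=> aij bi bj bc; apply/forallP => c.
have ij : i != j by apply: contraTneq isT => ij; rewrite ij bj in bi.
have [->{c}|cj] := eqVneq c j; last first.
  have [->{c cj}|ci] := eqVneq c i; last by apply: backed_at_write => //; apply: bc.
  apply/backed_atP => a k x aia ak /write_None[aj _].
  rewrite write_other // bi => -[<-].
  suff -> : k = j by rewrite write_same.
  apply/val_inj; move: aij aia ak aj; rewrite /adjacent -(inj_eq val_inj) /=; lia.
apply/backed_atP => a k x aja ak /write_None[_ ba].
rewrite write_same => -[<-]; rewrite otherK.
have ai : a != i by apply: contraTneq isT => ai; rewrite -ai ba in bi.
suff -> : k = i by rewrite write_other.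
apply/val_inj; move: aij aja ak ai; rewrite /adjacent -(inj_eq val_inj) /=; lia.
Qed.

Lemma backed_empty_board (n : nat) : backed (empty_board n).
Proof.
by apply/forallP => i; apply/backed_atP => j k l _ _ _; rewrite ffunE.
Qed.

(** * Keeping the board backed *)

(** The leftmost empty cell always works: its left neighbour, if it has one, is
    filled and can be paired with; the first cell of the grid has no second
    neighbour that would have to back it. *)
Lemma backed_opening (n : nat) (b : board n) :
  backed b -> ~~ full b ->
  exists m : move n, b m.1 = None /\ backed (write b m).
Proof.
move=> /forallP bb /forallPn[i0]; rewrite negbK => bi0.
case: (@arg_minnP _ i0 [pred i | b i == None] val bi0) => j /= /eqP bj jmin.
have [j0|j_gt0] := posnP j.
  exists (j, LetterS); split=> //; apply/forallP => c.
  have [->|cj] := eqVneq c j; last exact: backed_at_write.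
  apply/backed_atP => a k x; rewrite /adjacent j0; lia.
have pn : j.-1 < n by have := ltn_ord j; lia.
pose i := Ordinal pn.
have aij : adjacent i j by rewrite /adjacent /= prednK // eqxx.
case bi: (b i) => [l|]; last first.
  by have /= := jmin i; rewrite bi eqxx => /(_ isT); lia.
by exists (j, other l); split=> //; apply: (backed_write_adjacent aij bi bj).
Qed.

Lemma backed_reply (n : nat) (b : board n) (m : move n) :
  backed b -> b m.1 = None -> ~~ full (write b m) ->
  exists m' : move n,
    write b m m'.1 = None /\ backed (write (write b m) m').
Proof.
case: m => i l /= /forallP bb bi nfull; set b' := write _ _.
have bc c : c != i -> backed_at b' c by move=> ci; apply: backed_at_write.
have bi' : b' i = Some l by rewrite write_same.
have [/existsP[j /andP[aij /eqP bj]]|] :=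
  boolP [exists j, adjacent i j && (b' j == None)].
  exists (j, other l); split=> //; exact: (backed_write_adjacent aij bi' bj bc).
move=> /existsPn noempty; apply: backed_opening => //.
apply/forallP => c; have [->|] := eqVneq c i; last exact: bc.
by apply/backed_atP => j k x aij _ bj; have := noempty j; rewrite aij bj.
Qed.

(** * No string can be completed on a backed board *)

Lemma spells4P (n : nat) (b : board n) l :
  reflect (exists2 k, k + 4 <= n &
             forall i : 'I_n, k <= i < k + 4 -> b i = Some l)
          (spells4 b l).
Proof.
apply: (iffP existsP) => [[k /andP[kn /forallP bk]] | [k kn bk]].
  by exists k => // i ik; have := bk i; rewrite ik => /eqP.
have kltn : k < n by lia.
exists (Ordinal kltn); rewrite kn; apply/forallP => i; apply/implyP => ik.
by apply/eqP/bk.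
Qed.

Lemma not_spells4_write (n : nat) (b : board n) (m : move n) l :
  backed b -> b m.1 = None -> ~~ spells4 b l -> ~~ spells4 (write b m) l.
Proof.
case: m => j x /= /forallP bb bj; apply: contraNN => /spells4P[k kn bk].
have old (i : 'I_n) : i != j -> k <= i < k + 4 -> b i = Some l.
  by move=> ij /bk; rewrite write_other.
apply/spells4P; exists k => // i ik; apply: (old i) => //.
apply: contraTneq isT => ij; rewrite ij in ik.
(* [c] next to the empty cell and [d] beyond it carry the same letter, although
   [d] should back [c]. *)
have clash (c d : 'I_n) : adjacent c j -> j + d = c.*2 ->
    k <= c < k + 4 -> k <= d < k + 4 -> False.
  move=> acj jd ck dk.
  have cj : c != j by move: acj; rewrite /adjacent -(inj_eq val_inj) /=; lia.
  have dj : d != j by move: acj jd; rewrite /adjacent -(inj_eq val_inj) /=; lia.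
  have /backed_atP /(_ _ _ _ acj jd bj (old c cj ck)) := bb c.
  by rewrite (old d dj dk) => -[/esym/eqP]; rewrite (negPf (other_neq l)).
have [jk|jk] := leqP j k.+1.
  have cn : j.+1 < n by lia.
  have dn : j.+2 < n by lia.
  by case: (clash (Ordinal cn) (Ordinal dn)); rewrite /adjacent /=; lia.
have cn : j.-1 < n by lia.
have dn : j.-2 < n by lia.
by case: (clash (Ordinal cn) (Ordinal dn)); rewrite /adjacent /=; lia.
Qed.

Lemma not_completed_write (n : nat) (b : board n) (m : move n) :
  backed b -> b m.1 = None -> ~~ completed b -> ~~ completed (write b m).
Proof.
move=> bb bm; rewrite /completed !negb_or => /andP[nS nO].
by rewrite !not_spells4_write.
Qed.

(** * The strategy *)

Definition restores_backing (n : nat) (b : board n) (m : move n) : bool :=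
  (b m.1 == None) && backed (write b m).

Definition backing_strategy (n : nat) (m0 : move n) : strategy n :=
  fun h => odflt m0 [pick m | restores_backing (board_of h) m].

Lemma backing_strategyP (n : nat) (m0 : move n) (h : history n) :
  (exists m, restores_backing (board_of h) m) ->
  restores_backing (board_of h) (backing_strategy m0 h).
Proof.
by rewrite /backing_strategy => -[m Pm]; case: pickP => [//|/(_ m)]; rewrite Pm.
Qed.

Lemma board_of_rcons (n : nat) (h : history n) (m : move n) :
  board_of (rcons h m) = write (board_of h) m.
Proof. by rewrite /board_of foldl_rcons. Qed.

Lemma to_move_rcons (n : nat) (h : history n) (m : move n) :
  to_move (rcons h m) = opponent (to_move h).
Proof. by rewrite /to_move size_rcons /=; case: odd. Qed.

Lemma opponentK : involutive opponent. Proof. by case. Qed.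

Lemma follows_rcons (n : nat) p (s : strategy n) (h : history n) (m : move n) :
  follows p s (rcons h m) -> follows p s h /\ (to_move h = p -> m = s h).
Proof.
move=> fol; split=> [h1 m1 h2 eqh|]; last by apply: (fol h m [::]); rewrite cats0.
by apply: (fol h1 m1 (rcons h2 m)); rewrite eqh rcons_cat.
Qed.

Lemma wins_rcons (n : nat) p (h : history n) (m : move n) :
  wins p (rcons h m) -> to_move h = p /\ completed (board_of (rcons h m)).
Proof. by case=> _ [h' [m' [/rcons_inj[-> _]]]]. Qed.

(** The board is required to be backed only when the adversary is to move; at
    the player's own turns what matters is that it can be backed again. *)
Lemma backing_strategy_invariant (n : nat) (m0 : move n) p (h : history n) :
  play h -> follows p (backing_strategy m0) h -> ~~ finished h ->
  (to_move h = p -> exists m, restores_backing (board_of h) m) /\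
  (to_move h = opponent p -> backed (board_of h)).
Proof.
elim=> {h} [_ nfin | h m _ IH /andP[nfin /eqP hm]].
  have be := backed_empty_board n; split=> // _.
  have [|m [/eqP bm bbm]] := backed_opening be.
    by move: nfin; rewrite /finished negb_or => /andP[].
  by exists m; rewrite /restores_backing bm.
move=> /follows_rcons[/IH /(_ nfin) [IHp IHo] ms]; rewrite /finished negb_or.
move=> /andP[_]; rewrite to_move_rcons board_of_rcons => nfull.
split=> [hp | /(can_inj opponentK) hp].
  have bb : backed (board_of h) by apply: IHo; rewrite -hp opponentK.
  by have [m' [/eqP ? ?]] := backed_reply bb hm nfull; exists m'; apply/andP.
by rewrite (ms hp); have /andP[] := backing_strategyP m0 (IHp hp).
Qed.

Lemma backing_strategy_nonlosing (n : nat) (m0 : move n) p :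
  nonlosing p (backing_strategy m0).
Proof.
split=> [h ph fol hp nfin | h ph].
  have [/(_ hp) ex _] := backing_strategy_invariant ph fol nfin.
  by have /andP[bm _] := backing_strategyP m0 ex; rewrite /legal nfin.
case: ph => [_ [_ [[|? ?] [? [//]]]] | {}h m ph /andP[nfin /eqP hm]].
move=> /follows_rcons[fol _] /wins_rcons[hp].
have [_ /(_ hp) bb] := backing_strategy_invariant ph fol nfin.
rewrite board_of_rcons; apply/negP/not_completed_write => //.
by move: nfin; rewrite /finished negb_or => /andP[].
Qed.

Theorem theorem8 (n : nat) (n_ge1 : 1 <= n) : is_draw n.
Proof.
move=> p; exists (backing_strategy (Ordinal n_ge1, LetterS)).
exact: backing_strategy_nonlosing.
Qed.
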